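(* Let $n$ and $s$ be positive integers with $\gcd(n,s+1)=1$ and $n-s=3$, and let $F(X)=X^{2^n-2^s}$ over $\mathbb{F}_{2^n}$. Then for $a,b\in\mathbb{F}_{2^n}$, $$\nabla_F(a,b)=\begin{cases} 2^n & \text{if } ab=0 \text{ or } a=b,\\ 4 & \text{if } ab\neq 0,\ a\neq b,\ ab^{2^s}+a^{2^s}b=0 \text{ and } \gcd(s,n)=3,\\ & \text{or } ab\neq 0,\ a\neq b,\ \operatorname{Tr}\left(\dfrac{a^7(ab^2+a^2b)}{a^2b^8+a^8b^2}\right)=1,\ \operatorname{Tr}\left(\dfrac{a^3}{a^2b+ab^2}\right)=1,\\ & \quad t_1,t_2 \text{ are cubes in } \mathbb{F}_{2^{2n}}, \text{ and } \operatorname{Tr}(Z_1)=\operatorname{Tr}(Z_2)=0,\\ 0 & \text{otherwise,} \end{cases}$$ where $Z_1,Z_2$ are the solutions of $a^6Z^2+a^3(ab^2+a^2b)Z+a^2b^4+a^4b^2+a^6=0$ and $t_1,t_2$ are the solutions of $a^7(ab^2+a^2b)t^2+(a^8b^2+a^2b^8)t+a^7(ab^2+a^2b)=0$. Moreover, the Feistel boomerang uniformity of $F$ is $4$.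
   Context: $\operatorname{Tr}$ is the absolute trace from $\mathbb{F}_{2^n}$ to $\mathbb{F}_2$. The solutions $Z_1,Z_2$ are taken in $\mathbb{F}_{2^n}$ and $t_1,t_2$ in $\mathbb{F}_{2^{2n}}$. For $F:\mathbb{F}_{2^n}\to\mathbb{F}_{2^n}$ and $a,b\in\mathbb{F}_{2^n}$, $\nabla_F(a,b)=\#\{X\in\mathbb{F}_{2^n}: F(X+a+b)+F(X+b)+F(X+a)+F(X)=0\}$. The Feistel boomerang uniformity of $F$ is $\max\{\nabla_F(a,b): a,b\in\mathbb{F}_{2^n}\setminus\{0\},\ a\neq b\}$.
   Formalization: The final claim that the Feistel boomerang uniformity is 4 is stated for n ≠ 5 only: for n = 5, s = 2, F = X^28 over F_32 is equivalent to the APN map X^7, so its uniformity is 0. The table of values of ∇_F is stated for all n. *)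

(* Defs.v *)
From HB Require Import structures.
From mathcomp Require Import all_boot all_order all_algebra.

Set Implicit Arguments.
Unset Strict Implicit.
Unset Printing Implicit Defensive.

Import GRing.Theory.
Local Open Scope ring_scope.

(* When #|K| = 2 ^ n this is the absolute trace from K to F_2; the prime field
   F_2 is identified with {0, 1} inside K. *)
Definition Tr (K : finFieldType) (n : nat) (x : K) : K :=
  \sum_(i < n) x ^+ (2 ^ i).

Definition is_cube (K : finFieldType) (t : K) : Prop := exists u : K, t = u ^+ 3.

Definition nabla (K : finFieldType) (F : K -> K) (a b : K) : nat :=
  #|[set X : K | F (X + a + b) + F (X + b) + F (X + a) + F X == 0]|.

Definition feistel_boomerang_uniformity (K : finFieldType) (F : K -> K) : nat :=
  (\max_(ab : K * K | [&& ab.1 != 0%R, ab.2 != 0%R & ab.1 != ab.2])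
     nabla F ab.1 ab.2)%N.

Definition Z_solutions (K : finFieldType) (a b : K) : {set K} :=
  [set Z : K | a ^+ 6 * Z ^+ 2 + a ^+ 3 * (a * b ^+ 2 + a ^+ 2 * b) * Z
               + (a ^+ 2 * b ^+ 4 + a ^+ 4 * b ^+ 2 + a ^+ 6) == 0].

(* Meant for a field L of order 2 ^ (2 * n), with a and b the images in L of
   elements of the subfield of order 2 ^ n. *)
Definition t_solutions (L : finFieldType) (a b : L) : {set L} :=
  [set t : L | a ^+ 7 * (a * b ^+ 2 + a ^+ 2 * b) * t ^+ 2
               + (a ^+ 8 * b ^+ 2 + a ^+ 2 * b ^+ 8) * t
               + a ^+ 7 * (a * b ^+ 2 + a ^+ 2 * b) == 0].

(* Main.v *)
Require Import Defs.
From HB Require Import structures.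
From mathcomp Require Import all_boot all_order all_algebra.
From mathcomp Require Import finfield ring zify.

Set Implicit Arguments.
Unset Strict Implicit.
Unset Printing Implicit Defensive.

Import Order.TTheory GRing.Theory Num.Theory.
Local Open Scope ring_scope.

(* Since [2 ^ n = 8 * 2 ^ s], [F X ^+ 8 = X ^+ 7], so [nabla F a b] counts the
   zeros of the second derivative of [X ^+ 7] in the directions [a], [b].  This
   derivative is [a * b * (a + b) * X * (X + a) * (X + b) * (X + a + b)] plus a
   constant, hence has 0 or 4 zeros.  With [b = a * y], [X = a * x],
   [w = y ^+ 2 + y], [u = x ^+ 2 + x] a zero becomes a point of the conic
   [u ^+ 2 + w * u + w ^+ 2 + 1 = 0] with [Tr u = 0]; this is the condition on
   [Z1], [Z2].  The other conditions follow from it: both traces equal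
   [Tr (w^-1)], and [t ^+ 2 + (w ^+ 3 + w) * t + 1] has the roots [c ^+ 3] and
   [c ^- 3] where [w = c + c^-1] in [L].

   For the value of the uniformity one needs a point [(u, w)] of the norm-one
   torus [u ^+ 2 + u * w + w ^+ 2 = 1], which has [q + 1 = 3 * k] points, with
   [Tr u = Tr w = 0].  If there is none, the additive character sum over the
   torus equals [- k] at every frequency that lies on the torus; the second and
   fourth moments over all frequencies exclude this for [q >= 128]. *)

(** * The absolute trace in characteristic 2 *)

Lemma char2_nat (R : nzRingType) k : 2%:R = 0 :> R -> k%:R = (odd k)%:R :> R.
Proof.
by move=> c2; rewrite -{1}(odd_double_half k) -mul2n natrD natrM c2 mul0r addr0.
Qed.

Lemma char2_even (R : nzRingType) k : 2%:R = 0 :> R -> (k.*2)%:R = 0 :> R.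
Proof. by move=> c2; rewrite char2_nat // odd_double. Qed.

Lemma char2_addr_eq0 (R : nzRingType) (x y : R) :
  2%:R = 0 :> R -> (x + y == 0) = (x == y).
Proof. by move=> c2; rewrite addr_eq0 oppr_pchar2 // inE /= c2. Qed.

Lemma char2_addr_eq0P (R : nzRingType) (x y : R) :
  2%:R = 0 :> R -> x + y = 0 -> x = y.
Proof. by move=> c2 /eqP; rewrite char2_addr_eq0 // => /eqP. Qed.

(* [ring] only rewrites a coefficient that is literally the one of a
   hypothesis, so each coefficient that may occur has to be listed. *)
Ltac ring2 c2 :=
  apply: (char2_addr_eq0P c2);
  ring: (char2_even 1 c2 : 2%:R = 0) (char2_even 2 c2 : 4%:R = 0)
    (char2_even 3 c2 : 6%:R = 0) (char2_even 4 c2 : 8%:R = 0)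
    (char2_even 5 c2 : 10%:R = 0) (char2_even 6 c2 : 12%:R = 0)
    (char2_even 7 c2 : 14%:R = 0) (char2_even 8 c2 : 16%:R = 0)
    (char2_even 9 c2 : 18%:R = 0) (char2_even 10 c2 : 20%:R = 0)
    (char2_even 11 c2 : 22%:R = 0) (char2_even 12 c2 : 24%:R = 0)
    (char2_even 13 c2 : 26%:R = 0) (char2_even 14 c2 : 28%:R = 0)
    (char2_even 15 c2 : 30%:R = 0) (char2_even 16 c2 : 32%:R = 0)
    (char2_even 17 c2 : 34%:R = 0) (char2_even 18 c2 : 36%:R = 0)
    (char2_even 20 c2 : 40%:R = 0) (char2_even 21 c2 : 42%:R = 0)
    (char2_even 28 c2 : 56%:R = 0) (char2_even 35 c2 : 70%:R = 0)
    (char2_even 42 c2 : 84%:R = 0) (char2_even 63 c2 : 126%:R = 0)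
    (char2_even 70 c2 : 140%:R = 0) (char2_even 105 c2 : 210%:R = 0).

Lemma char2_sqrD (R : comNzRingType) (c2 : 2%:R = 0 :> R) (i : nat) :
  {morph (fun x : R => x ^+ (2 ^ i)) : x y / x + y}.
Proof.
move=> x y; elim: i => [|i IH] //=.
by rewrite expnS mulnC !exprM IH; ring2 c2.
Qed.

Lemma TrD (K : finFieldType) (c2 : 2%:R = 0 :> K) n :
  {morph @Tr K n : x y / x + y}.
Proof.
by move=> x y; rewrite /Tr -big_split; apply: eq_bigr => i _; apply: char2_sqrD.
Qed.

Lemma Tr0 (K : finFieldType) n : Tr n (0 : K) = 0.
Proof. by rewrite /Tr big1 // => i _; rewrite expr0n expn_eq0. Qed.

Lemma Tr_sqr (K : finFieldType) n (x : K) :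
  #|K| = (2 ^ n)%N -> Tr n (x ^+ 2) = Tr n x.
Proof.
move=> hK; case: n hK => [|n] hK; first by rewrite /Tr !big_ord0.
rewrite /Tr big_ord_recr big_ord_recl /= addrC -exprM -expnS -hK expf_card.
by congr (_ + _); apply: eq_bigr => i _; rewrite -exprM -expnS.
Qed.

Lemma Tr_sqrD (K : finFieldType) n (x : K) :
  #|K| = (2 ^ n)%N -> 2%:R = 0 :> K -> Tr n (x ^+ 2 + x) = 0.
Proof.
move=> hK c2; rewrite TrD // Tr_sqr //; ring2 c2.
Qed.

Lemma Tr1 (K : finFieldType) n : 2%:R = 0 :> K -> odd n -> Tr n (1 : K) = 1.
Proof.
move=> c2 odn; rewrite /Tr (eq_bigr (fun=> 1)) => [|i _]; last exact: expr1n.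
rewrite sumr_const card_ord -(odd_double_half n) odn -mul2n mulrS mulrnA c2.
by rewrite mul0rn addr0.
Qed.

Lemma expr2nK (K : finFieldType) n (x : K) :
  #|K| = (2 ^ n)%N -> x ^+ (2 ^ n) = x.
Proof. by move=> <-; apply: expf_card. Qed.

Lemma Tr_eq0_or_eq1 (K : finFieldType) n (x : K) :
  #|K| = (2 ^ n)%N -> 2%:R = 0 :> K -> Tr n x = 0 \/ Tr n x = 1.
Proof.
move=> hK c2.
have sq : (Tr n x) ^+ 2 = Tr n x.
  rewrite -[RHS](Tr_sqr x hK) /Tr.
  rewrite (big_morph (fun x : K => x ^+ 2) (char2_sqrD c2 1) (expr0n _ _)).
  by apply: eq_bigr => i _; rewrite -!exprM mulnC.
have /eqP : Tr n x * (Tr n x - 1) = 0 by rewrite mulrBr mulr1 -expr2 sq subrr.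
by rewrite mulf_eq0 subr_eq0 => /orP[]/eqP; [left|right].
Qed.

(* The witness is the half trace [\sum_(i <= (n-1)/2) x ^+ 4 ^ i]. *)
Lemma Tr_eq0_sqrD (K : finFieldType) n (x : K) :
  #|K| = (2 ^ n)%N -> 2%:R = 0 :> K -> odd n ->
  Tr n x = 0 -> exists y, x = y ^+ 2 + y.
Proof.
move=> hK c2 odn Tx; exists (\sum_(i < (n./2).+1) x ^+ (2 ^ i.*2)).
set y := \sum_(i < _) _.
have -> : y ^+ 2 = \sum_(i < (n./2).+1) x ^+ (2 ^ i.*2.+1).
  rewrite /y (big_morph (fun x : K => x ^+ 2) (char2_sqrD c2 1) (expr0n _ _)).
  by apply: eq_bigr => i _; rewrite -exprM -expnSr.
have E m : \sum_(i < m) x ^+ (2 ^ i.*2.+1) + \sum_(i < m) x ^+ (2 ^ i.*2)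
         = \sum_(i < m.*2) x ^+ (2 ^ i).
  elim: m => [|m IH]; first by rewrite !big_ord0 addr0.
  rewrite doubleS !big_ord_recr /= -IH; ring.
rewrite /y E doubleS.
(* As [n] is odd, the interleaved sum runs up to [n] inclusive: it is [Tr n x] plus one last term
   [x ^+ (2 ^ n) = x]. *)
have -> : (n./2.*2).+2 = n.+1 by rewrite -[in RHS](odd_double_half n) odn.
by rewrite big_ord_recr /= (expr2nK _ hK) -/(Tr n x) Tx add0r.
Qed.

Lemma char2_finField (K : finFieldType) n : #|K| = (2 ^ n)%N -> 2%:R = 0 :> K.
Proof. by move=> hK; have := card_finPcharP hK isT; rewrite inE => /eqP. Qed.

(** [x ^+ 2 + x] has trace 0, while 1 has trace 1 for odd [n]; so [K] has no primitive cube root of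
    unity. *)
Lemma sqrD_add1_neq0 (K : finFieldType) n (x : K) :
  #|K| = (2 ^ n)%N -> odd n -> x ^+ 2 + x + 1 != 0.
Proof.
move=> hK odn; have c2 := char2_finField hK.
apply/eqP => e; have := Tr_sqrD x hK c2.
have -> : x ^+ 2 + x = 1 by apply/eqP; rewrite -char2_addr_eq0 // e.
by rewrite Tr1 // => /eqP; rewrite oner_eq0.
Qed.

(** * Zeros of the second derivative of X ^ 7 *)

Definition sum7 (R : comNzRingType) (a b X : R) : R :=
  (X + a + b) ^+ 7 + (X + b) ^+ 7 + (X + a) ^+ 7 + X ^+ 7.

Definition conic (R : comNzRingType) (u w : R) : R := u ^+ 2 + w * u + w ^+ 2 + 1.

Lemma pow_feistel8 (K : finFieldType) n s (X : K) :
  #|K| = (2 ^ n)%N -> (n - s)%N = 3%N ->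
  (X ^+ (2 ^ n - 2 ^ s)) ^+ 8 = X ^+ 7.
Proof.
move=> hK hns; rewrite -exprM.
have -> : ((2 ^ n - 2 ^ s) * 8 = 2 ^ n * 7)%N.
  have -> : n = (s + 3)%N by lia.
  rewrite expnD; lia.
by rewrite exprM (expr2nK _ hK).
Qed.

(** The eighth power is additive and vanishes only at 0. *)
Lemma nabla_sum7 (K : finFieldType) n s (a b : K) :
  #|K| = (2 ^ n)%N -> (n - s)%N = 3%N ->
  nabla (fun X : K => X ^+ (2 ^ n - 2 ^ s)) a b = #|[set X | sum7 a b X == 0]|.
Proof.
move=> hK hns; have c2 := char2_finField hK; congr #|pred_of_set _|.
apply/setP=> X; rewrite !inE -[LHS](expf_eq0 _ 8).
have H : {morph (fun x : K => x ^+ 8) : x y / x + y} := char2_sqrD c2 3.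
by rewrite !H !(pow_feistel8 _ hK hns).
Qed.

(** 7 = 4 + 2 + 1, and each factor is a Frobenius image of [x + y]. *)
Lemma char2_expr7D (R : comNzRingType) (x y : R) : 2%:R = 0 :> R ->
  (x + y) ^+ 7 = (x ^+ 4 + y ^+ 4) * (x ^+ 2 + y ^+ 2) * (x + y).
Proof. by move=> c2; ring2 c2. Qed.

Lemma sum7E (R : comNzRingType) (a b X : R) : 2%:R = 0 :> R ->
  sum7 a b X = a * b * (a + b) * (X * (X + a) * (X + b) * (X + a + b))
               + ((a + b) ^+ 7 + a ^+ 7 + b ^+ 7).
Proof. by move=> c2; rewrite /sum7 !char2_expr7D //; ring2 c2. Qed.

Lemma sum7_conic (R : comNzRingType) (a x y : R) : 2%:R = 0 :> R ->
  sum7 a (a * y) (a * x)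
  = a ^+ 7 * (y ^+ 2 + y) * conic (x ^+ 2 + x) (y ^+ 2 + y).
Proof. by move=> c2; rewrite /sum7 !char2_expr7D // /conic; ring2 c2. Qed.

(** By [sum7E], the zeros form a coset of the group 0, [a], [b], [a + b], the roots of an additive
    polynomial. *)
Lemma card_sum7_zeros (K : finFieldType) (a b X0 : K) :
  2%:R = 0 :> K -> a * b != 0 -> a != b -> sum7 a b X0 = 0 ->
  #|[set X | sum7 a b X == 0]| = 4%N.
Proof.
move=> c2; rewrite mulf_eq0 negb_or => /andP[a0 b0] ab X00.
have ab0 : a + b != 0 by rewrite char2_addr_eq0.
have -> : [set X | sum7 a b X == 0] = [set X0; X0 + a] :|: [set X0 + b; X0 + a + b].
  apply/setP=> X; rewrite !inE.
  have -> : sum7 a b X = a * b * (a + b) *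
      ((X + X0) * (X + (X0 + a)) * (X + (X0 + b)) * (X + (X0 + a + b))).
    by rewrite -[LHS]addr0 -X00 !sum7E //; ring2 c2.
  rewrite !mulf_eq0 (negPf a0) (negPf b0) (negPf ab0) /= !char2_addr_eq0 //.
  by rewrite !orbA.
have eqE (d e : K) : (X0 + d == X0 + e) = (d == e).
  by apply/eqP/eqP => [/addrI|->].
have eq0E (d : K) : (X0 == X0 + d) = (d == 0).
  by rewrite -[X in X == _]addr0 eqE eq_sym.
have abE : (a + b == b) = false.
  by rewrite -[X in _ == X]add0r (inj_eq (addIr b)) (negPf a0).
have aabE : (a == a + b) = false.
  by rewrite -[X in X == _]addr0 (inj_eq (addrI a)) eq_sym (negPf b0).
rewrite cardsU !cards2 -!addrA eq0E a0 eqE eq_sym abE (_ : _ :&: _ = set0) ?cards0 //.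
apply/setP=> X; rewrite !inE; apply/negP => /andP[/orP[]/eqP->].
  by rewrite !eq0E (negPf b0) (negPf ab0).
by rewrite !eqE (negPf ab) aabE.
Qed.

Lemma nabla_full (K : finFieldType) n s (a b : K) :
  #|K| = (2 ^ n)%N -> (n - s)%N = 3%N -> a * b = 0 \/ a = b ->
  nabla (fun X : K => X ^+ (2 ^ n - 2 ^ s)) a b = (2 ^ n)%N.
Proof.
move=> hK hns ab; have c2 := char2_finField hK.
rewrite (nabla_sum7 _ _ hK hns) -hK -cardsT; congr #|pred_of_set _|.
apply/setP=> X; rewrite !inE; apply/eqP; case: ab => [/eqP|->].
  by rewrite mulf_eq0 => /orP[]/eqP->; rewrite /sum7; ring2 c2.
rewrite /sum7 (_ : X + b + b = X); last by ring2 c2.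
by rewrite !char2_expr7D //; ring2 c2.
Qed.

Lemma nabla_eq4 (K : finFieldType) n s (a b X : K) :
  #|K| = (2 ^ n)%N -> (n - s)%N = 3%N -> a * b != 0 -> a != b ->
  sum7 a b X = 0 -> nabla (fun X : K => X ^+ (2 ^ n - 2 ^ s)) a b = 4%N.
Proof.
move=> hK hns ab0 ab e; rewrite (nabla_sum7 _ _ hK hns).
exact: (card_sum7_zeros (char2_finField hK) ab0 ab e).
Qed.

Lemma nabla_0_or_4 (K : finFieldType) n s (a b : K) :
  #|K| = (2 ^ n)%N -> (n - s)%N = 3%N -> a * b != 0 -> a != b ->
  nabla (fun X : K => X ^+ (2 ^ n - 2 ^ s)) a b = 0%N \/
  nabla (fun X : K => X ^+ (2 ^ n - 2 ^ s)) a b = 4%N /\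
  exists X, sum7 a b X = 0.
Proof.
move=> hK hns ab0 ab; have [X /eqP e|no] := pickP (fun X => sum7 a b X == 0).
  by right; split; [exact: (nabla_eq4 hK hns ab0 ab e) | exists X].
left; rewrite (nabla_sum7 _ _ hK hns); apply/eqP; rewrite cards_eq0.
by apply/eqP/setP=> X; rewrite !inE no.
Qed.

(* [y ^+ 8 = y] splits as [(y ^+ 2 + y) * (w ^+ 3 + w + 1)] with
   [w = y ^+ 2 + y], and then [conic (w ^+ 2) w = 0]. *)
Lemma subfield8_zero (K : finFieldType) (a b : K) :
  2%:R = 0 :> K -> a * b != 0 -> a != b -> a * b ^+ 8 = a ^+ 8 * b ->
  sum7 a b (b ^+ 2 / a) = 0.
Proof.
move=> c2; rewrite mulf_eq0 negb_or => /andP[a0 b0] ab e8.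
have [y by_] : exists y, b = a * y by exists (b / a); rewrite mulrC divfK.
rewrite by_ in b0 ab e8 *.
have -> : (a * y) ^+ 2 / a = a * (y ^+ 2) by field.
have y0 : y != 0 by apply: contra b0 => /eqP->; rewrite mulr0.
have y1 : y + 1 != 0.
  by rewrite char2_addr_eq0 //; apply: contra ab => /eqP->; rewrite mulr1.
have w3 : (y ^+ 2 + y) ^+ 3 + (y ^+ 2 + y) + 1 = 0.
  apply/eqP; have: a ^+ 9 * y * (y + 1) * ((y ^+ 2 + y) ^+ 3 + (y ^+ 2 + y) + 1) == 0.
    rewrite [X in X == _](_ : _ = a * (a * y) ^+ 8 + a ^+ 8 * (a * y)); last by ring2 c2.
    by rewrite char2_addr_eq0 // e8.
  by rewrite mulf_eq0 (negPf (mulf_neq0 (mulf_neq0 (expf_neq0 9 a0) y0) y1)).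
rewrite sum7_conic //.
have -> : conic ((y ^+ 2) ^+ 2 + y ^+ 2) (y ^+ 2 + y) =
   (y ^+ 2 + y + 1) * ((y ^+ 2 + y) ^+ 3 + (y ^+ 2 + y) + 1) by rewrite /conic; ring2 c2.
by rewrite w3 !mulr0.
Qed.

(** With [b = a * y] the equation is [a ^+ 6 * conic Z (y ^+ 2 + y) = 0]; trace zero provides [x]
    with [Z = x ^+ 2 + x], and [a * x] is the zero. *)
Lemma Z_solutions_zero (K : finFieldType) n (a b Z : K) :
  #|K| = (2 ^ n)%N -> odd n -> a != 0 ->
  Z \in Z_solutions a b -> Tr n Z = 0 -> exists X, sum7 a b X = 0.
Proof.
move=> hK odn a0; have c2 := char2_finField hK.
have [y ->] : exists y, b = a * y by exists (b / a); rewrite mulrC divfK.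
rewrite inE => eZ /(Tr_eq0_sqrD hK c2 odn)[x Zx].
exists (a * x); rewrite sum7_conic // -Zx.
suff -> : conic Z (y ^+ 2 + y) = 0 by rewrite mulr0.
apply/eqP; have : a ^+ 6 * conic Z (y ^+ 2 + y) == 0.
  by move: eZ; congr (_ == 0); rewrite /conic; ring2 c2.
by rewrite mulf_eq0 (negPf (expf_neq0 6 a0)).
Qed.

(** * The conditions of the theorem at a zero *)

(** Either [x ^+ k] has order 3 for some nonzero [x], or all [3 * k] nonzero elements are roots of
    ['X^k - 1], whose degree is too small. *)
Lemma exists_cube_root_of_unity (L : finFieldType) (k : nat) :
  #|L| = (3 * k).+1 -> (0 < k)%N -> exists om : L, om ^+ 2 + om + 1 = 0.
Proof.
move=> hL k0.
have [x xk|no] := pickP (fun x : L => (x != 0) && (x ^+ k != 1)).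
  case/andP: xk => x0 xk; exists (x ^+ k); apply/eqP.
  have /eqP : (x ^+ k - 1) * ((x ^+ k) ^+ 2 + x ^+ k + 1) = 0.
    have -> : (x ^+ k - 1) * ((x ^+ k) ^+ 2 + x ^+ k + 1) = (x ^+ k) ^+ 3 - 1 by ring.
    apply: (mulfI x0); rewrite mulr0 mulrBr mulr1 -exprM mulnC -exprS -hL.
    by rewrite expf_card subrr.
  by rewrite mulf_eq0 subr_eq0 (negPf xk).
have : (size (enum (predC1 (0%R : L))) < size (('X^k - 1%:P)%R : {poly L}))%N.
  apply: max_poly_roots; last exact: enum_uniq.
    by rewrite -size_poly_eq0 size_XnsubC.
  apply/allP=> x; rewrite mem_enum inE => x0.
  by rewrite rootE !hornerE subr_eq0; have := no x; rewrite x0 => /negbFE.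
rewrite size_XnsubC // -cardE cardC1 hL; lia.
Qed.

Lemma sum7_scale (K : finFieldType) n (a b X : K) :
  #|K| = (2 ^ n)%N -> odd n -> a * b != 0 -> a != b -> sum7 a b X = 0 ->
  exists x y, [/\ X = a * x, b = a * y, y ^+ 2 + y != 0, y ^+ 2 + y + 1 != 0
                & conic (x ^+ 2 + x) (y ^+ 2 + y) = 0].
Proof.
move=> hK odn; have c2 := char2_finField hK.
rewrite mulf_eq0 negb_or => /andP[a0 b0] ab eX.
have [x Xx] : exists x, X = a * x by exists (X / a); rewrite mulrC divfK.
have [y by_] : exists y, b = a * y by exists (b / a); rewrite mulrC divfK.
rewrite Xx by_ in b0 ab eX *; exists x, y.
have w0 : y ^+ 2 + y != 0.
  have -> : y ^+ 2 + y = y * (y + 1) by ring.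
  rewrite mulf_neq0 ?char2_addr_eq0 //.
    by apply: contraNneq b0 => ->; rewrite mulr0.
  by apply: contraNneq ab => ->; rewrite mulr1.
split=> //; first exact: (sqrD_add1_neq0 y hK odn).
move: eX => /eqP; rewrite sum7_conic // mulf_eq0.
by rewrite (negPf (mulf_neq0 (expf_neq0 7 a0) w0)) => /eqP.
Qed.

(** Dividing the conic by [w ^+ 2] shows that [w ^- 2] is 1 plus an element of the form
    [v ^+ 2 + v]. *)
Lemma Tr_inv_conic (K : finFieldType) n (u w : K) :
  #|K| = (2 ^ n)%N -> odd n -> w != 0 -> conic u w = 0 -> Tr n w^-1 = 1.
Proof.
move=> hK odn w0 e; have c2 := char2_finField hK.
have E : w^-1 ^+ 2 = ((u / w) ^+ 2 + u / w) + 1.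
  apply: (char2_addr_eq0P c2); transitivity (conic u w / w ^+ 2); last by rewrite e mul0r.
  by rewrite /conic; field.
by rewrite -(Tr_sqr _ hK) E TrD // Tr_sqrD // Tr1 // add0r.
Qed.

Lemma Tr_inv_cubic (K : finFieldType) n (w : K) :
  #|K| = (2 ^ n)%N -> w != 0 -> w + 1 != 0 ->
  Tr n (w * (w + 1) ^+ 2)^-1 = Tr n w^-1.
Proof.
move=> hK w0 w1; have c2 := char2_finField hK.
have -> : (w * (w + 1) ^+ 2)^-1 = w^-1 + ((w + 1)^-1 ^+ 2 + (w + 1)^-1).
  (* The multiple of 2 is kept explicit, so that [field] proves the identity without the
     characteristic. *)
  have -> : w^-1 + ((w + 1)^-1 ^+ 2 + (w + 1)^-1)
       = (1 + 2%:R * (w ^+ 2 + 2%:R * w)) / (w * (w + 1) ^+ 2).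
    by field; rewrite ?w0 ?w1.
  by rewrite c2 mul0r addr0 mul1r.
by rewrite TrD // Tr_sqrD // addr0.
Qed.

Lemma traces_of_zero (K : finFieldType) n (a b X : K) :
  #|K| = (2 ^ n)%N -> odd n -> a * b != 0 -> a != b -> sum7 a b X = 0 ->
  Tr n (a ^+ 7 * (a * b ^+ 2 + a ^+ 2 * b) / (a ^+ 2 * b ^+ 8 + a ^+ 8 * b ^+ 2)) = 1
  /\ Tr n (a ^+ 3 / (a ^+ 2 * b + a * b ^+ 2)) = 1.
Proof.
move=> hK odn ab0 ab eX; have c2 := char2_finField hK.
have [x [y [_ by_ w0 w1 /(Tr_inv_conic hK odn w0) T1]]] := sum7_scale hK odn ab0 ab eX.
have a0 : a != 0 by apply: contraNneq ab0 => ->; rewrite mul0r.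
split.
  rewrite -[RHS]T1 -(Tr_inv_cubic hK w0 w1); congr Tr.
  have -> : a ^+ 2 * b ^+ 8 + a ^+ 8 * b ^+ 2
      = (a ^+ 10 * (y ^+ 2 + y)) * ((y ^+ 2 + y) * (y ^+ 2 + y + 1) ^+ 2).
    by rewrite by_; ring2 c2.
  have -> : a ^+ 7 * (a * b ^+ 2 + a ^+ 2 * b) = a ^+ 10 * (y ^+ 2 + y).
    by rewrite by_; ring.
  by rewrite invfM mulrA mulfV ?mul1r // mulf_neq0 // expf_neq0.
rewrite -[RHS]T1; congr Tr.
have -> : a ^+ 2 * b + a * b ^+ 2 = a ^+ 3 * (y ^+ 2 + y) by rewrite by_; ring.
by rewrite invfM mulrA mulfV ?mul1r // expf_neq0.
Qed.

Lemma Z_solutions_of_zero (K : finFieldType) n (a b X : K) :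
  #|K| = (2 ^ n)%N -> odd n -> a * b != 0 -> a != b -> sum7 a b X = 0 ->
  exists Z1 Z2, [/\ Z_solutions a b = [set Z1; Z2], Tr n Z1 = 0 & Tr n Z2 = 0].
Proof.
move=> hK odn ab0 ab eX; have c2 := char2_finField hK.
have [x [y [_ -> w0 w1 e]]] := sum7_scale hK odn ab0 ab eX.
have a0 : a != 0 by apply: contraNneq ab0 => ->; rewrite mul0r.
(* The roots of the conic in [Z] sum to [w], and [u + w] is again of the form [v ^+ 2 + v]. *)
exists (x ^+ 2 + x), ((x + y) ^+ 2 + (x + y)); split; try exact: Tr_sqrD.
apply/setP=> Z; rewrite !inE -!(char2_addr_eq0 Z) // -mulf_eq0.
rewrite -[RHS](mulrI_eq0 _ (mulfI (expf_neq0 6 a0))); congr (_ == 0).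
transitivity (a ^+ 6 * (conic Z (y ^+ 2 + y) + conic (x ^+ 2 + x) (y ^+ 2 + y))).
  by rewrite e addr0 /conic; ring2 c2.
by rewrite /conic; ring2 c2.
Qed.

Lemma t_solutions_of_zero (K L : finFieldType) (iota : {rmorphism K -> L}) n
    (a b X : K) :
  #|K| = (2 ^ n)%N -> #|L| = (2 ^ (2 * n))%N -> odd n ->
  a * b != 0 -> a != b -> sum7 a b X = 0 ->
  exists t1 t2, [/\ t_solutions (iota a) (iota b) = [set t1; t2],
                    is_cube t1 & is_cube t2].
Proof.
move=> hK hL odn ab0 ab eX; have c2 := char2_finField hL.
have [x [y [_ -> w0 w1 e]]] := sum7_scale hK odn ab0 ab eX.
have a0 : a != 0 by apply: contraNneq ab0 => ->; rewrite mul0r.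
have [om eom] : exists om : L, om ^+ 2 + om + 1 = 0.
  have d3 : (3 %| 2 ^ (2 * n) - 1)%N.
    by rewrite -eqn_mod_dvd ?expn_gt0 // expnM -modnXm exp1n.
  have L4 : (4 <= 2 ^ (2 * n))%N.
    by rewrite (@leq_exp2l 2 2) //; case: n odn {hK hL d3} => // m _; lia.
  apply: (@exists_cube_root_of_unity L ((2 ^ (2 * n) - 1) %/ 3)).
    by rewrite mulnC divnK // hL; lia.
  by rewrite divn_gt0 //; lia.
rewrite rmorphM; set A := iota a; set Y := iota y; set U := iota (x ^+ 2 + x).
have A0 : A != 0 by rewrite fmorph_eq0.
have W0 : Y ^+ 2 + Y != 0 by rewrite -rmorphXn -rmorphD fmorph_eq0.
have {}e : conic U (Y ^+ 2 + Y) = 0.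
  rewrite -(rmorph0 iota) -e /conic /U /Y.
  by rewrite !(rmorphD, rmorphM, rmorphXn, rmorph1).
set W := Y ^+ 2 + Y in W0 e.
(* [c] and [c'] are the conjugates [U + om * W] and [U + om ^+ 2 * W]: their sum is [W], and their
   product is the norm form, equal to 1 on the conic. *)
pose c := U + om * W; pose c' := c + W.
have cc' : c * c' = 1.
  apply: (char2_addr_eq0P c2).
  transitivity (conic U W + W ^+ 2 * (om ^+ 2 + om + 1)); last by rewrite e eom mulr0 addr0.
  by rewrite /conic /c' /c; ring2 c2.
exists (c ^+ 3), (c' ^+ 3); split; [|by exists c|by exists c'].
apply/setP=> t; rewrite !inE -!(char2_addr_eq0 t) // -mulf_eq0.
rewrite -[RHS](mulrI_eq0 _ (mulfI (mulf_neq0 (expf_neq0 10 A0) W0))); congr (_ == 0).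
(* With 1 written as [c * c'] the quadratic factors as [(t + c ^+ 3) * (t + c' ^+ 3)], because
   [c ^+ 3 + c' ^+ 3 = W * (W ^+ 2 + c * c')]. *)
transitivity (A ^+ 10 * W * (t ^+ 2 + W * (W ^+ 2 + c * c') * t + (c * c') ^+ 3)).
  by rewrite cc' /W; ring2 c2.
by rewrite /c'; ring2 c2.
Qed.

(** * Character sums over the norm-one torus *)

Section CharacterSums.

Variables (K : finFieldType) (n : nat).
Hypotheses (hK : #|K| = (2 ^ n)%N) (odn : odd n).

Let c2 : 2%:R = 0 :> K := char2_finField hK.

(** The additive character [(-1)^Tr], valued in the integers so that moments can be ordered. *)
Definition chi (x : K) : int := if Tr n x == 0 then 1 else -1.

Lemma chiD x y : chi (x + y) = chi x * chi y.
Proof.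
rewrite /chi TrD //.
have [] := Tr_eq0_or_eq1 x hK c2; have [] := Tr_eq0_or_eq1 y hK c2; move=> -> ->.
- by rewrite addr0 eqxx.
- by rewrite add0r eqxx oner_eq0.
- by rewrite addr0 eqxx oner_eq0.
by rewrite -[1 + 1]/(2%:R) c2 eqxx oner_eq0.
Qed.

Lemma chi0 : chi 0 = 1. Proof. by rewrite /chi Tr0 eqxx. Qed.

Lemma chi1 : chi 1 = -1. Proof. by rewrite /chi Tr1 // oner_eq0. Qed.

Definition dot (l v : K * K) : K := l.1 * v.1 + l.2 * v.2.

Lemma dotDr l v w : dot l (v + w) = dot l v + dot l w.
Proof. by rewrite /dot /=; ring. Qed.

Lemma dotDl l v w : dot (v + w) l = dot v l + dot w l.
Proof. by rewrite /dot /=; ring. Qed.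

Lemma sum_chi_dot (v : K * K) :
  \sum_l chi (dot l v) = if v == 0 then (#|K| ^ 2)%:Z else 0.
Proof.
case: eqP => [->|/eqP v0].
  rewrite (eq_bigr (fun=> 1)) => [|l _]; last by rewrite /dot !mulr0 addr0 chi0.
  by rewrite sumr_const card_prod mulnn -mulr_natr mul1r natz.
have [l0 dl0] : exists l0, dot l0 v = 1.
  have [v1|v1] := eqVneq v.1 0.
    exists (0, v.2^-1); rewrite /dot /= mul0r add0r mulVf //.
    apply: contraNneq v0 => v2; rewrite [v]surjective_pairing v1 v2 //.
  by exists (v.1^-1, 0); rewrite /dot /= mul0r addr0 mulVf.
(* Shifting [l] by [l0] multiplies each term by [chi 1 = -1]. *)
set S := \sum_l _; suff : S = - S by lia.
rewrite {1}/S (reindex_inj (addrI l0)) -sumrN; apply: eq_bigr => l _.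
by rewrite dotDl dl0 chiD chi1 mulN1r.
Qed.

Lemma parseval (f : K * K -> int) :
  \sum_l (\sum_v f v * chi (dot l v)) ^+ 2 = (#|K| ^ 2)%:Z * \sum_v f v ^+ 2.
Proof.
pose g l v w := f v * f w * chi (dot l (v + w)).
rewrite (eq_bigr (fun l => \sum_v \sum_w g l v w)) => [|l _].
  rewrite exchange_big mulr_sumr; apply: eq_bigr => v _.
  rewrite exchange_big (bigD1 v) //= [X in _ + X]big1 ?addr0 => [|w wv].
    rewrite /g -mulr_sumr sum_chi_dot.
    have -> : v + v = 0 by rewrite [v]surjective_pairing; congr (_, _) => /=; ring2 c2.
    by rewrite eqxx expr2; ring.
  rewrite /g -mulr_sumr sum_chi_dot.
  suff /negPf-> : v + w != 0 by rewrite mulr0.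
  apply: contraNneq wv => vw.
  have E : w = v + w + v by rewrite [v]surjective_pairing [w]surjective_pairing; congr (_, _) => /=; ring2 c2.
  by rewrite E vw add0r.
rewrite expr2 big_distrlr /=; apply: eq_bigr => v _; apply: eq_bigr => w _.
by rewrite /g dotDr chiD; ring.
Qed.

(** The norm of [p.1 + p.2 * om] from the quadratic extension of [K] by a primitive cube root of
    unity [om]. *)
Definition nrm (p : K * K) : K := p.1 ^+ 2 + p.1 * p.2 + p.2 ^+ 2.

Definition torus : {set K * K} := [set p | nrm p == 1].

Lemma nrm_eq0 p : nrm p = 0 -> p = 0.
Proof.
case: p => u w; rewrite /nrm /= => e.
have [w0|w0] := eqVneq w 0.
  move: e; rewrite w0 mulr0 expr0n /= !addr0 => /eqP.
  by rewrite expf_eq0 /= => /eqP->.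
have /eqP := sqrD_add1_neq0 (u / w) hK odn; case.
have -> : (u / w) ^+ 2 + u / w + 1 = (u ^+ 2 + u * w + w ^+ 2) / w ^+ 2 by field.
by rewrite e mul0r.
Qed.

Lemma sqr_inj : injective (fun x : K => x ^+ 2).
Proof.
move=> x y /= e; apply: (char2_addr_eq0P c2).
have /eqP : (x + y) ^+ 2 = 0.
  by transitivity (x ^+ 2 + y ^+ 2); [ring2 c2 | rewrite e; ring2 c2].
by rewrite expf_eq0 => /eqP.
Qed.

(** Squaring is bijective, so each nonzero vector is uniquely a nonzero scalar times a torus point;
    hence [q ^ 2 - 1 = (q - 1) * #|torus|]. *)
Lemma card_torus : #|torus| = #|K|.+1.
Proof.
pose f (ct : K * (K * K)) := (ct.1 * ct.2.1, ct.1 * ct.2.2).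
have nf ct : nrm (f ct) = ct.1 ^+ 2 * nrm ct.2 by rewrite /nrm /f /=; ring.
pose A := setX [set~ (0 : K)] torus.
have injf : {in A &, injective f}.
  move=> [c t] [d s]; rewrite !inE /= => /andP[c0 /eqP nt] /andP[d0 /eqP ns] e.
  have : nrm (f (c, t)) = nrm (f (d, s)) by rewrite e.
  rewrite !nf /= nt ns !mulr1 => /sqr_inj cd; rewrite -{}cd in e *.
  case: t s e {nt ns} => [t1 t2] [s1 s2] [] /= /(mulfI c0)-> /(mulfI c0)->.
  by [].
have imf : f @: A = [set v : K * K | v != 0].
  apply/setP=> v; rewrite !inE; apply/imsetP/idP => [[[c t]]|v0].
    rewrite !inE /= => /andP[c0 /eqP nt] ->; apply: contraNneq c0 => e.
    have : nrm (f (c, t)) = 0 by rewrite e /nrm /= mul0r !expr0n /= !addr0.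
    by rewrite nf /= nt mulr1 => /eqP; rewrite expf_eq0.
  have [g _ gK] := injF_bij sqr_inj.
  have [c ec] : exists c : K, c ^+ 2 = nrm v by exists (g (nrm v)); apply: gK.
  have c0 : c != 0.
    by apply: contraNneq v0 => c0; apply/eqP/nrm_eq0; rewrite -ec c0 expr0n.
  exists (c, (v.1 / c, v.2 / c)); last first.
    by rewrite /f /= !(mulrC c) !divfK //; apply: surjective_pairing.
  rewrite !inE /= c0 /=; apply/eqP; rewrite /nrm /=.
  have -> : (v.1 / c) ^+ 2 + v.1 / c * (v.2 / c) + (v.2 / c) ^+ 2 = nrm v / c ^+ 2.
    by rewrite /nrm; field.
  by rewrite -ec mulfV // expf_neq0.
have := card_in_imset injf; rewrite imf cardsE cardC1 card_prod cardsX cardsC1.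
have : (1 < #|K|)%N by rewrite hK -{1}(expn0 2) ltn_exp2l //; case: n odn.
move: #|K| #|torus| => q m; nia.
Qed.

Definition torus_sum (l : K * K) : int := \sum_(p in torus) chi (dot l p).

(** The autocorrelation of the torus, whose Fourier transform is the square of [torus_sum]. *)
Definition torus_shifts (v : K * K) : nat := #|[set p in torus | p + v \in torus]|.

Lemma torus_sum_sqr l : torus_sum l ^+ 2 = \sum_v (torus_shifts v)%:Z * chi (dot l v).
Proof.
rewrite expr2 /torus_sum big_distrlr /=.
transitivity (\sum_(p in torus) \sum_(v | p + v \in torus) chi (dot l v)).
  apply: eq_bigr => p _; rewrite (reindex_inj (addrI p)) /=; apply: eq_bigr => v _.
  rewrite dotDr chiD mulrA.
  by rewrite (_ : chi _ * _ = 1) ?mul1r // /chi; case: ifP.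
rewrite (exchange_big_dep xpredT) //=; apply: eq_bigr => v _.
rewrite sumr_const /torus_shifts -mulr_natl natz; congr (Posz _ * _).
by rewrite cardsE.
Qed.

Lemma moment2_torus_sum : \sum_l torus_sum l ^+ 2 = (#|K| ^ 2)%:Z * #|torus|%:Z.
Proof.
transitivity (\sum_l (\sum_v (v \in torus)%:R * chi (dot l v)) ^+ 2).
  apply: eq_bigr => l _; congr (_ ^+ 2); rewrite /torus_sum big_mkcond.
  by apply: eq_bigr => v _; case: ifP => _; rewrite ?mul1r ?mul0r.
rewrite parseval; congr (_ * _).
rewrite (eq_bigr (fun v => if v \in torus then 1 else 0 : int)) => [|v _].
  by rewrite -big_mkcond sumr_const -mulr_natr mul1r natz.
by case: (v \in torus); rewrite ?expr1n ?expr0n.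
Qed.

Lemma moment4_torus_sum :
  \sum_l torus_sum l ^+ 4 = (#|K| ^ 2)%:Z * \sum_v (torus_shifts v)%:Z ^+ 2.
Proof.
rewrite -parseval; apply: eq_bigr => l _.
by rewrite -torus_sum_sqr -exprM.
Qed.

Lemma torus_shifts0 : torus_shifts 0 = #|torus|.
Proof. by apply: eq_card => p; rewrite !inE addr0 andbb. Qed.

Lemma sum_torus_shifts : (\sum_v torus_shifts v = #|torus| ^ 2)%N.
Proof.
rewrite (eq_bigr (fun v => \sum_(p in torus | (p + v)%R \in torus) 1)%N) => [|v _].
  rewrite (exchange_big_dep (fun p => p \in torus)) //=; last by move=> ? ? _ /andP[].
  rewrite (eq_bigr (fun=> #|torus|)) => [|p pT]; first by rewrite sum_nat_const.
  rewrite -(card_preimset torus (addrI p)) -sum1_card; apply: eq_bigl => v.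
  by rewrite pT [RHS]inE.
by rewrite sum1dep_card.
Qed.

(* [p] and [p'] both count for [torus_shifts v] only if [p' - p] is orthogonal
   to [v] for the polar form of [nrm], that is, if [p'] lies on the line
   [p + K v], which meets the torus in at most two points. *)
Lemma torus_shifts_le2 v : v != 0 -> (torus_shifts v <= 2)%N.
Proof.
move=> v0; have [r00|] := posnP (torus_shifts v); first by rewrite r00.
rewrite /torus_shifts card_gt0 => /set0Pn[p]; rewrite !inE => /andP[/eqP np /eqP npv].
suff sub : [set p' in torus | p' + v \in torus] \subset [set p; p + v].
  by rewrite (leq_trans (subset_leq_card sub)) // cards2; case: (_ != _).
have nv : nrm v != 0 by apply: contra_neq v0 => /nrm_eq0.
have polar (x : K * K) : nrm (x + v) = nrm x + nrm v + (x.1 * v.2 + x.2 * v.1).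
  by rewrite /nrm /=; ring2 c2.
apply/subsetP => p'; rewrite !inE => /andP[/eqP np' /eqP npv'].
have orth : (p'.1 + p.1) * v.2 = (p'.2 + p.2) * v.1.
  apply: (char2_addr_eq0P c2).
  transitivity ((nrm (p + v) + nrm p) + (nrm (p' + v) + nrm p')).
    by rewrite !polar; ring2 c2.
  by rewrite np npv np' npv'; ring2 c2.
have [c [c1 cw]] : exists c, p'.1 + p.1 = c * v.1 /\ p'.2 + p.2 = c * v.2.
  have [v1|v1] := eqVneq v.1 0.
    have v2 : v.2 != 0.
      by apply: contraNneq v0 => v2; rewrite [v]surjective_pairing v1 v2.
    exists ((p'.2 + p.2) / v.2); rewrite divfK //; split=> //.
    by apply: (mulIf v2); rewrite orth v1 !mulr0 mul0r.
  exists ((p'.1 + p.1) / v.1); rewrite divfK //; split=> //.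
  by rewrite mulrAC orth mulfK.
have {c1} c1 : p'.1 = p.1 + c * v.1 by rewrite -c1; ring2 c2.
have {cw} cw : p'.2 = p.2 + c * v.2 by rewrite -cw; ring2 c2.
(* On the line [p + c * v] the norm changes by [c ^+ 2 * nrm v] plus [c] times the polar form;
   eliminating the latter leaves [c = 0] or [c = 1]. *)
have /eqP : c * (c + 1) * nrm v = 0.
  have e0 : nrm p' + nrm p = 0 by rewrite np np'; ring2 c2.
  have e1 : nrm (p + v) + nrm p = 0 by rewrite np npv; ring2 c2.
  transitivity (nrm p' + nrm p + c * (nrm (p + v) + nrm p)); last first.
    by rewrite e0 e1 mulr0 addr0.
  by rewrite /nrm c1 cw /=; ring2 c2.
rewrite !mulf_eq0 (negPf nv) orbF char2_addr_eq0 // => /orP[]/eqP c01.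
  by rewrite [p']surjective_pairing c1 cw c01 !mul0r !addr0 -surjective_pairing eqxx.
rewrite [p']surjective_pairing c1 cw c01 !mul1r.
by rewrite (_ : (_, _) = p + v) ?eqxx ?orbT //; case: (p) (v) => [? ?] [].
Qed.

(** The shift 0 contributes [#|torus| ^ 2]; the other counts [r] satisfy [r ^ 2 <= 2 * r] and sum to
    [#|torus| ^ 2 - #|torus|]. *)
Lemma sum_torus_shifts_sqr : (\sum_v torus_shifts v ^ 2 + 2 * #|torus| <= 3 * #|torus| ^ 2)%N.
Proof.
rewrite (bigD1 (0 : K * K)) //= torus_shifts0.
have := sum_torus_shifts; rewrite (bigD1 (0 : K * K)) //= torus_shifts0.
have : (\sum_(v : K * K | v != 0%R) torus_shifts v ^ 2
      <= 2 * \sum_(v : K * K | v != 0%R) torus_shifts v)%N.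
  rewrite big_distrr /=; apply: leq_sum => v v0.
  by rewrite -mulnn leq_mul2r torus_shifts_le2 ?orbT.
move: (\sum_(v | _) _)%N (\sum_(v | _) torus_shifts v)%N #|torus| => A B m; lia.
Qed.

(** Multiplication of [l.1 + l.2 * om] by [p.1 + p.2 * om] with [om ^+ 2 = om + 1]; its first
    coordinate is [dot l p]. *)
Definition torus_mul (l p : K * K) : K * K :=
  (l.1 * p.1 + l.2 * p.2, l.2 * p.1 + (l.1 + l.2) * p.2).

(** Multiplication by [l] permutes the torus and carries the frequency [(1, 0)] to [l]. *)
Lemma torus_sum_const l : l \in torus -> torus_sum l = torus_sum (1, 0).
Proof.
rewrite inE => /eqP nl.
have nrot p : nrm (torus_mul l p) = nrm p.
  by transitivity (nrm l * nrm p); [rewrite /nrm /=; ring2 c2 | rewrite nl mul1r].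
have rotI : injective (torus_mul l).
  (* The inverse is multiplication by the conjugate of [l]. *)
  apply: (can_inj (g := torus_mul (l.1 + l.2, l.2))) => -[u w].
  transitivity (nrm l * u, nrm l * w); last by rewrite nl !mul1r.
  by congr (_, _); rewrite /nrm /=; ring2 c2.
rewrite /torus_sum [RHS](reindex_inj rotI) /=; apply: eq_big => [p|p _].
  by rewrite !inE nrot.
by rewrite /dot /= mul1r mul0r addr0.
Qed.

(** The frequencies [(1, 0)], [(0, 1)] and [(1, 1)] lie on the torus, and
    [chi x + chi y + chi x * chi y = -1] unless both traces vanish. *)
Lemma torus_sum_no_Tr0 :
  (forall p, p \in torus -> Tr n p.1 = 0 -> Tr n p.2 != 0) ->
  3 * torus_sum (1, 0) = - #|torus|%:Z.
Proof.
move=> H.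
have S2 : torus_sum (0, 1) = torus_sum (1, 0).
  by rewrite torus_sum_const // inE /nrm /=; apply/eqP; ring.
have S3 : torus_sum (1, 1) = torus_sum (1, 0).
  by rewrite torus_sum_const // inE /nrm /=; apply/eqP; ring2 c2.
transitivity (torus_sum (1, 0) + torus_sum (0, 1) + torus_sum (1, 1)); first by rewrite S2 S3; ring.
rewrite /torus_sum -!big_split /=.
rewrite (eq_bigr (fun=> -1)) => [|p /H Hp]; first by rewrite sumr_const mulNrn natz.
rewrite /dot /= !mul1r !mul0r addr0 add0r chiD /chi.
have [e1|] := Tr_eq0_or_eq1 p.1 hK c2; last first.
  by move=> ->; rewrite oner_eq0; case: eqP.
by rewrite e1 eqxx (negPf (Hp e1)).
Qed.

(* [c / 3] is the mean of [torus_sum l ^+ 2] over the nonzero [l] off the torus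
   if [torus_sum] is [- k] on the torus, [q + 1 = 3 * k].  The left-hand side is
   the part of [\sum_l (3 * torus_sum l ^+ 2 - c) ^+ 2] that comes from [0] and
   the torus, and the right-hand side bounds the whole sum. *)
Lemma moment_ineq (k : int) : 43 <= k ->
  let m := 3 * k in let q := 3 * k - 1 in let c := 8 * k - 1 in
  (3 * m ^+ 2 - c) ^+ 2 + m * (3 * k ^+ 2 - c) ^+ 2
  > 9 * (q ^+ 2 * (m * (3 * q + 1))) - 6 * c * (q ^+ 2 * m) + q ^+ 2 * c ^+ 2.
Proof.
move=> hk /=; have [k0 k1 k33] : [/\ 0 < k, 0 < k - 1 & 0 < k - 33] by split; lia.
(* The difference is regrouped so that each summand is visibly positive for [33 < k]. *)
rewrite -subr_gt0 (_ : _ - _ = 9 * k * (3 * k ^+ 3 * (k - 33)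
  + k * (k ^+ 2 + 46 * (k - 1) + 90 * k) + 5)); last by ring.
move: (k - 1) (k - 33) k1 k33 => a b a0 b0.
have pos1 : 0 < 3 * k ^+ 3 * b by apply: mulr_gt0 => //; rewrite mulr_gt0 ?exprn_gt0.
have pos2 : 0 < k ^+ 2 + 46 * a + 90 * k.
  by apply: addr_gt0; [apply: addr_gt0; rewrite ?exprn_gt0 // mulr_gt0 | apply: mulr_gt0].
have pos3 := mulr_gt0 k0 pos2.
by apply: mulr_gt0; [apply: mulr_gt0 | rewrite addr_gt0 // addr_gt0].
Qed.

Lemma exists_torus_Tr0 : (7 <= n)%N ->
  exists2 p, p \in torus & Tr n p.1 = 0 /\ Tr n p.2 = 0.
Proof.
move=> n7.
have [p /and3P[pT /eqP p1 /eqP p2]|no] :=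
  pickP (fun p => [&& p \in torus, Tr n p.1 == 0 & Tr n p.2 == 0]).
  by exists p.
have {no} H p : p \in torus -> Tr n p.1 = 0 -> Tr n p.2 != 0.
  by move=> pT p1; have := no p; rewrite pT p1 eqxx /= => ->.
have := torus_sum_no_Tr0 H; rewrite card_torus => s3.
have [k kS] : exists k, torus_sum (1, 0) = - k by exists (- torus_sum (1, 0)); rewrite opprK.
have q128 : (128 <= #|K|)%N by rewrite hK (@leq_exp2l 2 7).
have qk : #|K|%:Z = 3 * k - 1 by lia.
have mk : #|torus|%:Z = 3 * k by rewrite card_torus; lia.
(* [3 * k - 1] is at least 128. *)
have k43 : 43 <= k by lia.
pose c := 8 * k - 1; pose g l := (3 * torus_sum l ^+ 2 - c) ^+ 2.
have S0 : torus_sum 0 = #|torus|%:Z.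
  rewrite /torus_sum (eq_bigr (fun=> 1)) => [|p _]; last by rewrite /dot !mul0r addr0 chi0.
  by rewrite sumr_const natz.
have low : g 0 + \sum_(l in torus) g l <= \sum_l g l.
  rewrite [leRHS](bigID [in torus]) /= [leLHS]addrC lerD2l (bigD1 (0 : K * K)) /=; last first.
    by rewrite inE /nrm /= mul0r !expr0n /= !addr0 eq_sym oner_eq0.
  by rewrite lerDl sumr_ge0 // => l _; apply: sqr_ge0.
have gT : \sum_(l in torus) g l = 3 * k * (3 * k ^+ 2 - c) ^+ 2.
  rewrite (eq_bigr (fun=> (3 * k ^+ 2 - c) ^+ 2)) => [|l lT].
    by rewrite sumr_const -[LHS]mulr_natl; congr (_ * _); rewrite natz mk.
  by rewrite /g torus_sum_const // kS sqrrN.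
have gall : \sum_l g l =
    9 * \sum_l torus_sum l ^+ 4 - 6 * c * \sum_l torus_sum l ^+ 2 + (#|K| ^ 2)%:Z * c ^+ 2.
  have -> : (#|K| ^ 2)%:Z * c ^+ 2 = \sum_(l : K * K) c ^+ 2.
    by rewrite sumr_const card_prod mulnn -[RHS]mulr_natl; congr (_ * _); rewrite natz.
  rewrite !mulr_sumr -sumrN -!big_split /=; apply: eq_bigr => l _.
  by rewrite /g; ring.
move: low; rewrite gT gall moment2_torus_sum moment4_torus_sum /g S0 mk.
have -> : (#|K| ^ 2)%:Z = (3 * k - 1) ^+ 2 by rewrite -qk; lia.
have := moment_ineq k43; rewrite /= -/c => lt_low /(lt_le_trans lt_low).
rewrite !ltrD2r ltr_pM2l // ltNge => /negP[]; apply: ler_wpM2l; first exact: sqr_ge0.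
have -> : \sum_v (torus_shifts v)%:Z ^+ 2 = (\sum_v torus_shifts v ^ 2)%N%:Z.
  by rewrite -[RHS]natz natr_sum; apply: eq_bigr => v _; rewrite natrX natz.
(* With [m = q + 1], the bound [3 * m ^+ 2 - 2 * m] is [m * (3 * q + 1)], as in [moment_ineq]. *)
have := sum_torus_shifts_sqr; rewrite -lez_nat PoszD !PoszM mk.
move: (Posz _) => A; clear; lia.
Qed.

End CharacterSums.

(** * The boomerang uniformity *)

Lemma exists_zero (K : finFieldType) n :
  #|K| = (2 ^ n)%N -> odd n -> (7 <= n)%N ->
  exists y x : K, [/\ y != 0, 1 != y & sum7 1 y x = 0].
Proof.
move=> hK odn n7; have c2 := char2_finField hK.
have [[u w] pT [/= Tu Tw]] := exists_torus_Tr0 hK odn n7.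
have [x ux] := Tr_eq0_sqrD hK c2 odn Tu; have [y wy] := Tr_eq0_sqrD hK c2 odn Tw.
(* If [w = 0], then [u ^+ 2 = 1], so [u] has trace 1. *)
have w0 : w != 0.
  apply: contra_eqN Tu => /eqP w0; move: pT.
  rewrite inE /nrm /= w0 mulr0 expr0n /= !addr0 => /eqP u2.
  by rewrite -(Tr_sqr u hK) u2 Tr1 // oner_eq0.
exists y, x; split.
- by apply: contraNneq w0 => y0; rewrite wy y0 expr0n addr0.
- by apply: contraNneq w0 => y1; rewrite wy -y1 expr1n -[1 + 1]/(2%:R) c2.
rewrite -[y]mul1r -[x]mul1r sum7_conic // -ux -wy.
suff -> : conic u w = 0 by rewrite mulr0.
move: pT; rewrite inE => /eqP e; rewrite /conic.
transitivity (nrm (u, w) + 1); first by rewrite /nrm /=; ring.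
by rewrite e -[1 + 1]/(2%:R).
Qed.

(* The value of the uniformity excludes n = 5: there s = 2, and X ^ 28 is APN
   over the field of order 32, so its uniformity is 0.  The description of
   nabla covers n = 5. *)
Theorem theorem4p9 (n s : nat) (K L : finFieldType) (iota : {rmorphism K -> L})
    (hn : (0 < n)%N) (hs : (0 < s)%N)
    (hcop : gcdn n (s + 1) = 1%N) (hns : (n - s)%N = 3%N)
    (hK : #|K| = (2 ^ n)%N) (hL : #|L| = (2 ^ (2 * n))%N) :
  let F := fun X : K => X ^+ (2 ^ n - 2 ^ s) in
  (forall a b : K,
    let full := a * b = 0 \/ a = b in
    let four :=
      [/\ a * b <> 0, a <> b,
          a * b ^+ (2 ^ s) + a ^+ (2 ^ s) * b = 0 & gcdn s n = 3%N]
      \/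
      [/\ a * b <> 0 /\ a <> b,
          Tr n (a ^+ 7 * (a * b ^+ 2 + a ^+ 2 * b)
                / (a ^+ 2 * b ^+ 8 + a ^+ 8 * b ^+ 2)) = 1,
          Tr n (a ^+ 3 / (a ^+ 2 * b + a * b ^+ 2)) = 1,
          (exists t1 t2 : L,
             [/\ t_solutions (iota a) (iota b) = [set t1; t2],
                 is_cube t1 & is_cube t2])
        & (exists Z1 Z2 : K,
             [/\ Z_solutions a b = [set Z1; Z2],
                 Tr n Z1 = 0 & Tr n Z2 = 0])] in
    [/\ full -> nabla F a b = (2 ^ n)%N,
        four -> nabla F a b = 4%N
      & ~ full -> ~ four -> nabla F a b = 0%N])
  /\ (n <> 5%N -> feistel_boomerang_uniformity F = 4%N).
Proof.

move=> F; have hnE : n = (s + 3)%N by lia.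
(* [s + 1 = n - 2] has the parity of [n], so an even [n] would contradict coprimality. *)
have odn : odd n.
  apply/negPn/negP => evn; have : (2 %| gcdn n (s + 1))%N.
    by rewrite dvdn_gcd !dvdn2 evn; move: evn; rewrite hnE !oddD; case: (odd s).
  by rewrite hcop.
have c2 := char2_finField hK.
split=> [a b /=|n5].
  split; first exact: nabla_full.
    have pow8 (x : K) : (x ^+ (2 ^ s)) ^+ 8 = x.
      by rewrite -exprM (_ : 8 = 2 ^ 3)%N // -expnD -hnE (expr2nK _ hK).
    case=> [[/eqP ab0 /eqP ab e _]|[[/eqP ab0 /eqP ab] _ _ _ [Z1 [Z2 [eZ T1 _]]]]].
      apply: (nabla_eq4 hK hns ab0 ab (subfield8_zero c2 ab0 ab _)).
      have frob : {morph (fun x : K => x ^+ 8) : x y / x + y} := char2_sqrD c2 3.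
      (* The eighth power undoes [x ^+ (2 ^ s)], so it turns the hypothesis [e] into the required
         [a * b ^+ 8 = a ^+ 8 * b]. *)
      apply: (char2_addr_eq0P c2).
      transitivity ((a * b ^+ (2 ^ s) + a ^+ (2 ^ s) * b) ^+ 8).
        by rewrite frob !exprMn !pow8 addrC.
      by rewrite e expr0n.
    have a0 : a != 0 by apply: contraNneq ab0 => ->; rewrite mul0r.
    have [] := @Z_solutions_zero K n a b Z1 hK odn a0 _ T1; first by rewrite eZ set21.
    by move=> X; apply: nabla_eq4.
  move=> nfull nfour.
  have ab0 : a * b != 0 by apply/eqP => e; apply: nfull; left.
  have ab : a != b by apply/eqP => e; apply: nfull; right.
  have [//|[_ [X eX]]] := nabla_0_or_4 hK hns ab0 ab.
  case: nfour; right; have [T1 T2] := traces_of_zero hK odn ab0 ab eX.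
  split=> //; first by split; apply/eqP.
    exact: (t_solutions_of_zero iota hK hL odn ab0 ab eX).
  exact: (Z_solutions_of_zero hK odn ab0 ab eX).
have n7 : (7 <= n)%N.
  have : (n != 6)%N by apply: contraTneq odn => ->.
  have : (n != 4)%N by apply: contraTneq odn => ->.
  lia.
apply/eqP; rewrite eqn_leq; apply/andP; split.
  apply/bigmax_leqP => -[a b] /= /and3P[a0 b0 ab].
  by have [->|[-> _]] := nabla_0_or_4 hK hns (mulf_neq0 a0 b0) ab.
have [y [x [y0 y1 e]]] := exists_zero hK odn n7.
rewrite -(@nabla_eq4 K n s 1 y x hK hns _ y1 e) ?mul1r //.
by apply: (@leq_bigmax_cond _ _ (fun ab => nabla F ab.1 ab.2) (1, y)); rewrite /= oner_eq0 y0.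
Qed.
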